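(* Let $Y$ be a real Banach space, let $X\subset Y$ be a nonzero closed subspace, and let $J\colon X\to Y$ be the inclusion operator. If the pair $(X,Y)$ has the Daugavet property, then $(X,Y)$ has the Daugavet property for weakly compact operators; that is, $\|J+T\|=1+\|T\|$ for every weakly compact operator $T\colon X\to Y$.
   Context: The pair $(X,Y)$ has the Daugavet property for a class $\mathcal{M}\subset L(X,Y)$ of bounded linear operators if $\|J+T\|=1+\|T\|$ for all $T\in\mathcal{M}$, where $J\colon X\to Y$ is the inclusion. The pair $(X,Y)$ is said to have the Daugavet property (with no class mentioned) if this holds for the class $\mathcal M$ of all bounded linear operators $X\to Y$ of rank $1$. *)

(* Defs.v *)
From HB Require Import structures.
From mathcomp Require Import all_boot all_order all_algebra.
From mathcomp Require Import all_classical all_reals all_analysis.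

Set Implicit Arguments.
Unset Strict Implicit.
Unset Printing Implicit Defensive.

Import Order.TTheory GRing.Theory Num.Theory.
Import numFieldNormedType.Exports.

Local Open Scope classical_set_scope.
Local Open Scope ring_scope.

(* A linear subspace X of Y, viewed as a normed space in its own right; the
   inclusion J : X -> Y is [\val]. *)
Definition subspace_type (R : realType) (Y : normedModType R)
  (X : submodClosed Y) : Type := {y : Y | y \in X}.

Section SubspaceNormed.
Variables (R : realType) (Y : normedModType R) (X : submodClosed Y).

HB.instance Definition _ := SubChoice.on (subspace_type X).
HB.instance Definition _ := [SubChoice_isSubLmodule of subspace_type X by <:].

Definition subspace_norm (x : subspace_type X) : R := `|\val x|.

Lemma subspace_normD x y :
  subspace_norm (x + y) <= subspace_norm x + subspace_norm y.
Proof. by rewrite /subspace_norm raddfD ler_normD. Qed.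

Lemma subspace_normZ (l : R) x :
  subspace_norm (l *: x) = `|l| * subspace_norm x.
Proof. by rewrite /subspace_norm linearZ normrZ. Qed.

Lemma subspace_norm0_eq0 x : subspace_norm x = 0 -> x = 0.
Proof. by move=> /normr0_eq0 x0; apply: val_inj; rewrite x0 raddf0. Qed.

HB.instance Definition _ := Lmodule_isNormed.Build R (subspace_type X)
  subspace_normD subspace_normZ subspace_norm0_eq0.

End SubspaceNormed.

Section Operators.
Variables (R : realType) (V W : normedModType R).

Definition unit_ball : set V := [set x | `|x| <= 1].

(* The supremum is taken in R, so it is only meaningful for bounded T. *)
Definition opnorm (T : V -> W) : R := sup [set `|T x| | x in unit_ball].

(* The range is the line spanned by some nonzero vector. *)
Definition rank_one : set {linear V -> W} :=
  [set T | exists2 e : W, e != 0 & range T = range (fun c : R => c *: e)].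

End Operators.

Definition dual (R : realType) (V : normedModType R) : Type :=
  {f : {linear V -> R^o} | bounded_fun_norm f}.

(* V with the coarsest topology making every bounded functional continuous. *)
Definition weak (R : realType) (V : normedModType R) : topologicalType :=
  sup_topology (fun f : dual V =>
    Topological.class (initial_topology (proj1_sig f : V -> R^o))).

Definition weakly_compact (R : realType) (V W : normedModType R) :
    set {linear V -> W} :=
  [set T | @precompact (weak W) (T @` @unit_ball R V)].

Section Daugavet.
Variables (R : realType) (Y : normedModType R) (X : submodClosed Y).

Definition daugavet_property_for (M : set {linear subspace_type X -> Y}) :=
  forall T : {linear subspace_type X -> Y}, bounded_fun_norm T -> M T ->
    opnorm (\val \+ T) = 1 + opnorm T.

Definition daugavet_property :=
  daugavet_property_for (@rank_one R (subspace_type X) Y).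

End Daugavet.

(* Main.v *)
Require Import Defs.
From HB Require Import structures.
From mathcomp Require Import all_boot all_order all_algebra.
From mathcomp Require Import all_classical all_reals all_analysis.
From mathcomp Require Import lra.

Import Order.TTheory GRing.Theory Num.Theory.
Import numFieldNormedType.Exports.

Local Open Scope classical_set_scope.
Local Open Scope ring_scope.

(** The proof works with slices [S = {x | `|x| <= 1, a < f x}] of the unit ball
    of [X].

    Applied to the operators [f (x) y], the Daugavet property says that every
    slice contains a smaller slice on which [`|x + y| >= 1 + `|y| - e]
    ([daugavet_slice]); the smaller slice is cut out by a combination of [f] and
    a functional of [Y] that almost norms both the point [x] and the vector [y].
    One slice can thus be shrunk to be good for finitely many [y] at once.

    Given a weakly compact [T], one builds decreasing slices [S n] with points
    [x n] in [S n], at each stage making the next slice good for all midpoints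
    of the vectors considered so far and of [T (x n)] ([daugavet_sequence]).
    Let [D] be the set of all vectors considered. It is stable under midpoints
    and contains every [T (x n)]. By weak compactness the sequence [T (x n)] has
    a weak cluster point [y]. By Mazur's theorem ([mazur_closure]) [y] is a norm
    limit of points [d] of [D], and also of points of [T @` S n] for each [n].
    Choose [d] in [D] close to [y], then [n] such that [S n] is good for [d],
    and then [z] in [S n] with [T z] close to [y]. Since [T z] is close to [d],
    the number [`|z + T z|] is almost at least [1 + `|T z|]
    ([daugavet_weakly_compact_slice]).

    When the first slice is cut out by [u \o T], with [u] a norming functional
    of some [T x] of almost maximal norm, [`|T z|] is almost the norm of [T],
    which gives [opnorm (\val \+ T) >= 1 + opnorm T]. This replaces the usual
    appeal to strongly exposed points of weakly compact convex sets.

    Norming functionals and Mazur's theorem both come from the sandwich form of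
    the Hahn-Banach theorem ([mazur_orlicz]), which is obtained from minimal
    sublinear functionals. *)

(** * The Hahn-Banach theorem in sandwich form *)

(** Requiring only [<=] in the homogeneity condition is enough; equality is
    [sublinearZ]. *)
Definition sublinear {R : realType} {V : lmodType R} (p : V -> R) :=
  (forall x y, p (x + y) <= p x + p y) /\
  (forall t x, 0 <= t -> p (t *: x) <= t * p x).

Definition segment_closed {R : realType} {V : lmodType R} (D : set V) :=
  forall s t a b, 0 <= s -> 0 <= t -> s + t = 1 -> D a -> D b ->
    D (s *: a + t *: b).

Lemma ex_linear {R : realType} {V W : lmodType R} (f : V -> W) :
  (forall x y, f (x + y) = f x + f y) ->
  (forall t x, f (t *: x) = t *: f x) ->
  exists F : {linear V -> W}, F = f :> (V -> W).
Proof.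
move=> fD fZ.
have lf : linear f by move=> t x y; rewrite fD fZ.
pose L := GRing.isLinear.Build R V W *:%R f lf.
pose F : {linear V -> W} := HB.pack f L.
by exists F.
Qed.

Lemma functionalZ {R : realType} {V : lmodType R} (f : {linear V -> R^o}) t x :
  f (t *: x) = t * f x.
Proof. by rewrite linearZ. Qed.

Section HahnBanach.
Context {R : realType} {V : lmodType R}.
Implicit Types (p q : V -> R) (D : set V).

Lemma sublinear0 p : sublinear p -> p 0 = 0.
Proof.
move=> [pD pZ]; have := pZ 0 0 (lexx _); have := pD 0 0.
rewrite scale0r addr0 mul0r; lra.
Qed.

Lemma sublinearZ p t x : sublinear p -> 0 <= t -> p (t *: x) = t * p x.
Proof.
move=> sp t0; apply/le_anti/andP; split; first exact: sp.2.
have [->|tn0] := eqVneq t 0; first by rewrite scale0r sublinear0// mul0r.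
have tp : 0 < t by rewrite lt_def tn0.
have := sp.2 t^-1 (t *: x); rewrite invr_ge0 scalerA mulVf// scale1r => /(_ t0).
by rewrite ler_pdivlMl.
Qed.

Lemma sublinear_opp p x : sublinear p -> - p (- x) <= p x.
Proof. by move=> sp; have := sp.1 x (- x); rewrite subrr sublinear0//; lra. Qed.

(** The witness is [x |-> inf (p (x + t d) - t c)] over [0 <= t] and [d] in [D].
    Convexity of [D] makes [t d + s e] a multiple of a point of [D], hence the
    infimum subadditive; the bound [c <= p] on [D] keeps it above [- p (- x)]. *)
Lemma sublinear_minorant p D c : sublinear p -> segment_closed D ->
    D !=set0 -> (forall d, D d -> c <= p d) ->
  exists q, [/\ sublinear q, forall x, q x <= p x &
    forall d, D d -> q (- d) <= - c].
Proof.
move=> sp convD [d0 Dd0] cp.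
pose E x := [set p (x + td.1 *: td.2) - td.1 * c |
              td in [set td : R * V | 0 <= td.1 /\ D td.2]].
have E0 x : E x !=set0 by exists (p (x + 0 *: d0) - 0 * c); exists (0, d0).
have Elb x : has_lbound (E x).
  exists (- p (- x)) => _ [[t d] /= [t0 Dd] <-].
  have := sp.1 (x + t *: d) (- x); rewrite addrAC subrr add0r sublinearZ//.
  have := ler_wpM2l t0 (cp _ Dd); lra.
pose q x := inf (E x).
have qle x t d : 0 <= t -> D d -> q x <= p (x + t *: d) - t * c.
  by move=> t0 Dd; apply: ge_inf => //; exists (t, d).
have ge_q x b : (forall t d, 0 <= t -> D d -> b <= p (x + t *: d) - t * c) ->
    b <= q x.
  by move=> h; apply: lb_le_inf => // _ [[t d] /= [t0 Dd] <-]; exact: h.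
have qp x : q x <= p x.
  by have := qle x 0 d0 (lexx _) Dd0; rewrite scale0r addr0 mul0r subr0.
exists q; split => //; last first.
  move=> d Dd; have := qle (- d) 1 d ler01 Dd.
  by rewrite scale1r addNr sublinear0// mul1r sub0r.
split=> [x y|k x k0].
  suff: q (x + y) - q y <= q x by rewrite lerBlDr.
  apply: (ge_q) => t d t0 Dd.
  suff: q (x + y) - (p (x + t *: d) - t * c) <= q y by lra.
  apply: (ge_q) => s e s0 De; rewrite lerBlDl.
  have [ts0|tsn0] := eqVneq (t + s) 0.
    have -> : t = 0 by lra.
    have -> : s = 0 by lra.
    rewrite !scale0r !addr0 !mul0r !subr0.
    exact: le_trans (qp _) (sp.1 _ _).
  have tsp : 0 < t + s by rewrite lt_def tsn0 addr_ge0.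
  have Dde : D ((t / (t + s)) *: d + (s / (t + s)) *: e).
    apply: convD => //; rewrite ?divr_ge0 ?addr_ge0//.
    by rewrite -mulrDl divff.
  apply: le_trans (qle _ _ _ (addr_ge0 t0 s0) Dde) _.
  rewrite scalerDr !scalerA [_ * (t / _)]mulrC [_ * (s / _)]mulrC !divfK//.
  have := sp.1 (x + t *: d) (y + s *: e); rewrite addrACA; lra.
have [->|kn0] := eqVneq k 0.
  by rewrite scale0r mul0r; apply: le_trans (qp _) _; rewrite sublinear0.
have kp : 0 < k by rewrite lt_def kn0.
rewrite -ler_pdivrMl//; apply: (ge_q) => t d t0 Dd; rewrite ler_pdivrMl//.
apply: le_trans (qle _ (k * t) d _ Dd) _; first exact: mulr_ge0.
rewrite -scalerA -scalerDr sublinearZ// mulrBr mulrA; lra.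
Qed.

(** Zorn's lemma: the pointwise infimum of a chain of sublinear functionals below
    [p] is again one, since it is bounded below at [x] by [- p (- x)]. *)
Lemma sublinear_minimal p : sublinear p ->
  exists q, [/\ sublinear q, forall x, q x <= p x &
    forall q', sublinear q' -> (forall x, q' x <= q x) ->
      forall x, q x <= q' x].
Proof.
move=> sp.
pose T := {q : V -> R | sublinear q /\ forall x, q x <= p x}.
pose t0 : T := exist _ p (conj sp (fun x => lexx (p x))).
pose below (q r : T) := `[< forall x, sval r x <= sval q x >].
have [||A totA|q qmin] := @ZL_preorder T t0 below.
- by move=> q; apply/asboolP => x.
- move=> q r s /asboolP qr /asboolP rs; apply/asboolP => x.
  exact: le_trans (rs x) (qr x).
- have [A0|[q0 Aq0]] : A = set0 \/ A !=set0.
    by have [->|/set0P] := eqVneq A set0; [left|right].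
    by exists t0 => s; rewrite A0.
  pose E x := [set sval q x | q in A].
  have E0 x : E x !=set0 by exists (sval q0 x); exists q0.
  have Elb x : has_lbound (E x).
    exists (- p (- x)) => _ [q Aq <-].
    have [sq qp] := svalP q.
    have := sublinear_opp _ x sq; have := qp (- x); rewrite /=; lra.
  pose m x := inf (E x).
  have mle x (q : T) : A q -> m x <= sval q x.
    by move=> Aq; apply: ge_inf => //; exists q.
  have le_m x b : (forall q : T, A q -> b <= sval q x) -> b <= m x.
    by move=> h; apply: lb_le_inf => // _ [q Aq <-]; exact: h.
  have sm : sublinear m.
    split=> [x y|k x k0].
      suff: m (x + y) - m y <= m x by rewrite lerBlDr.
      apply: (le_m) => q Aq.
      suff: m (x + y) - sval q x <= m y by lra.
      apply: (le_m) => r Ar; rewrite lerBlDl.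
      have [/asboolP qr|/asboolP rq] := totA _ _ Aq Ar.
        apply: le_trans (mle _ _ Ar) _.
        apply: le_trans ((svalP r).1.1 _ _) _.
        by rewrite lerD2r.
      apply: le_trans (mle _ _ Aq) _.
      apply: le_trans ((svalP q).1.1 _ _) _.
      by rewrite lerD2l.
    have [->|kn0] := eqVneq k 0.
      rewrite scale0r mul0r; apply: le_trans (mle _ _ Aq0) _.
      by rewrite sublinear0//; exact: (svalP q0).1.
    have kp : 0 < k by rewrite lt_def kn0.
    rewrite -ler_pdivrMl//; apply: (le_m) => q Aq; rewrite ler_pdivrMl//.
    apply: le_trans (mle _ _ Aq) _; exact: (svalP q).1.2.
  have mp x : m x <= p x.
    by apply: le_trans (mle _ _ Aq0) _; exact: (svalP q0).2.
  by exists (exist _ m (conj sm mp)) => q Aq; apply/asboolP => x; exact: mle.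
exists (sval q); have [sq qp] := svalP q; split => // q' sq' q'q.
have q'p x : q' x <= p x by exact: le_trans (q'q x) (qp x).
by have /(_ _)/asboolP := qmin (exist _ q' (conj sq' q'p)); apply; apply/asboolP.
Qed.

(** A minimal sublinear functional [q] is linear: the minorant obtained from
    [D = {z}] and [c = q z] must coincide with [q], so that [q (- z) = - q z],
    and an odd subadditive function is additive. The constraint [c <= f] on [D]
    is imposed beforehand, by minimizing below the minorant for [D]. *)
Lemma mazur_orlicz p D c : sublinear p -> segment_closed D ->
    D !=set0 -> (forall d, D d -> c <= p d) ->
  exists f : {linear V -> R^o}, (forall x, f x <= p x) /\
    (forall d, D d -> c <= f d).
Proof.
move=> sp convD D0 cp.
have [p' [sp' p'p p'D]] := sublinear_minorant _ _ _ sp convD D0 cp.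
have [q [sq qp' qmin]] := sublinear_minimal _ sp'.
have qN z : q (- z) = - q z.
  have := @sublinear_minorant q [set z] (q z) sq.
  case=> [s t a b _ _ st -> ->||_ ->//|r [sr rq rz]].
  - by rewrite -scalerDl st scale1r.
  - by exists z.
  have := qmin _ sr rq (- z); have := rz z erefl.
  have := sublinear_opp _ (- z) sq; rewrite opprK; lra.
have qD x y : q (x + y) = q x + q y.
  apply/le_anti/andP; split; first exact: sq.1.
  by have := sq.1 (- x) (- y); rewrite -opprD !qN; lra.
have qZ t x : q (t *: x) = t * q x.
  have [t0|/ltW t0] := leP 0 t; first exact: sublinearZ.
  rewrite -[t]opprK scaleNr qN sublinearZ ?oppr_ge0//; lra.
have [F Fq] := ex_linear (q : V -> R^o) qD qZ; exists F; split=> [x|d Dd].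
  by rewrite Fq; apply: le_trans (qp' x) _.
rewrite Fq; have := qp' (- d); have := p'D d Dd; rewrite qN; lra.
Qed.

End HahnBanach.

Definition midpoint_closed {R : realType} {V : lmodType R} (D : set V) :=
  forall a b, D a -> D b -> D (2^-1 *: (a + b)).

(** * Norming functionals, Mazur's theorem, weak cluster points *)

Section NormedSpace.
Context {R : realType} {V : normedModType R}.
Implicit Types (D : set V) (u : {linear V -> R^o}).

Lemma closure_normP D v :
  closure D v <-> forall e, 0 < e -> exists2 d, D d & `|v - d| < e.
Proof.
split=> [clv e e0|h B /nbhs_ballP[e /= e0 eB]].
  have [|d [Dd]] := clv (ball v e); first exact: nbhsx_ballx.
  by rewrite -ball_normE /= => vd; exists d.
by have [d Dd vd] := h _ e0; exists d; split=> //; apply: eB; rewrite -ball_normE.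
Qed.

(** Induction on [n]: the point at parameter [t <= 1/2] is the midpoint of [b] and
    of the point at parameter [2 t], so replacing the latter by an approximation
    halves the error; the case [t >= 1/2] is symmetric. *)
Lemma midpoint_closed_dyadic D a b n t : midpoint_closed D -> D a -> D b ->
    0 <= t <= 1 ->
  exists2 d, D d & `|t *: a + (1 - t) *: b - d| <= `|a - b| / 2 ^+ n.
Proof.
move=> midD Da Db; elim: n t => [|n IH] t /andP[t0 t1].
  exists b => //; rewrite expr0 divr1 scalerBl scale1r addrA addrAC addrK.
  by rewrite -scalerBr normrZ ger0_norm// ler_piMl.
have halve (v w : V) : `|v| <= `|a - b| / 2 ^+ n -> w = 2^-1 *: v ->
    `|w| <= `|a - b| / 2 ^+ n.+1.
  move=> h ->; rewrite normrZ ger0_norm ?invr_ge0// exprS invfM mulrCA.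
  by rewrite ler_wpM2l// invr_ge0.
have [t2|/ltW t2] := leP t 2^-1.
  have [|d Dd dle] := IH (2 * t); first by apply/andP; split; lra.
  exists (2^-1 *: (d + b)); first exact: midD.
  apply: halve dle _; rewrite scalerBr !scalerDr !scalerA mulKf ?pnatr_eq0//.
  have -> : 1 - t = 2^-1 * (1 - 2 * t) + 2^-1 by lra.
  by rewrite scalerDl addrA opprD addrACA subrr addr0.
have [|d Dd dle] := IH (2 * t - 1); first by apply/andP; split; lra.
exists (2^-1 *: (a + d)); first exact: midD.
apply: halve dle _; rewrite scalerBr !scalerDr !scalerA opprD !addrA.
congr (_ - _); rewrite addrAC -scalerBl; congr (_ *: _ + _ *: _); lra.
Qed.

Lemma midpoint_closed_closure D :
  midpoint_closed D -> segment_closed (closure D).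
Proof.
move=> midD s t a b s0 t0 st /closure_normP cla /closure_normP clb.
apply/closure_normP => e e0.
have e3 : 0 < e / 3 by rewrite divr_gt0.
have [a' Da' aa'] := cla _ e3; have [b' Db' bb'] := clb _ e3.
have [n /andP[_ nlt]] : exists n, 0 <= `|a' - b'| / 2 ^+ n < e / 3.
  exists (Num.bound (`|a' - b'| / (e / 3))).
  rewrite divr_ge0 ?exprn_ge0//= ltr_pdivrMr ?exprn_gt0// mulrC.
  rewrite -ltr_pdivrMr//.
  apply: lt_le_trans (archi_boundP _) _; first by rewrite divr_ge0// ltW.
  rewrite -natrX ler_nat ltnW//; exact: ltn_expl.
have [|d Dd dle] := midpoint_closed_dyadic D a' b' n s midD Da' Db'.
  by apply/andP; split; lra.
exists d => //.
have -> : s *: a + t *: b - d = s *: (a - a') + t *: (b - b') +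
    (s *: a' + (1 - s) *: b' - d).
  have <- : t = 1 - s by lra.
  by rewrite !scalerBr [X in _ = X + _]addrACA -opprD addrA subrK.
apply: le_lt_trans (ler_normD _ _) _.
have : `|s *: (a - a') + t *: (b - b')| <= e / 3.
  apply: le_trans (ler_normD _ _) _; rewrite !normrZ !ger0_norm//.
  have -> : e / 3 = s * (e / 3) + t * (e / 3) by rewrite -mulrDl st mul1r.
  by rewrite lerD// ler_wpM2l// ltW.
lra.
Qed.

Lemma normr_sublinear : sublinear (fun x : V => `|x|).
Proof.
split=> [x y|t x t0]; first exact: ler_normD.
by rewrite normrZ ger0_norm.
Qed.

(** The sandwich theorem below the norm, for the single point [y]. *)
Lemma norming_functional (y : V) : exists u,
  (forall x, `|u x| <= `|x|) /\ u y = `|y|.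
Proof.
have [||//|u [ule uy]] := mazur_orlicz _ [set y] `|y| normr_sublinear.
- by move=> s t a b _ _ st -> ->; rewrite -scalerDl st scale1r.
- by exists y.
- by move=> d ->.
exists u; split=> [x|]; last first.
  by apply/le_anti; rewrite ule uy.
rewrite ler_norml ule andbT lerNl -[- _]linearN.
by apply: le_trans (ule _) _; rewrite normrN.
Qed.

(** Mazur's theorem: if [y] were at positive distance [e] from [D], the sandwich
    theorem below the norm on the convex set [closure D - y] would give a bounded
    [u] with [u d >= e + u y] on [D]. *)
Lemma mazur_closure D y : midpoint_closed D -> D !=set0 ->
    (forall u c, bounded_fun_norm u -> (forall d, D d -> c <= u d) ->
       c <= u y) ->
  closure D y.
Proof.
move=> midD [d0 Dd0] sep; apply: contrapT => nclDy.
have [e e0 De] : exists2 e, 0 < e & forall d, closure D d -> e <= `|d - y|.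
  have [e [e0 De]] : exists e, 0 < e /\ forall d, D d -> e <= `|y - d|.
    apply: contrapT => h; apply: nclDy; apply/closure_normP => e e0.
    apply: contrapT => h'; apply: h; exists e; split=> // d Dd.
    by rewrite leNgt; apply/negP => yd; apply: h'; exists d.
  exists (e / 2); first by rewrite divr_gt0.
  move=> d /closure_normP/(_ (e / 2)) [|d' Dd' dd']; first by rewrite divr_gt0.
  have := De _ Dd'; rewrite distrC.
  have := ler_distD d y d'; rewrite (distrC y d') (distrC y d); lra.
have clD d : D d -> closure D d by exact: subset_closure.
have [||d [v vD <-]|u [ule uD]] := mazur_orlicz _ [set v - y | v in closure D] e
  normr_sublinear.
- move=> s t _ _ s0 t0 st [a Da <-] [b Db <-].
  exists (s *: a + t *: b); first exact: midpoint_closed_closure.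
  by rewrite !scalerBr addrACA -opprD -scalerDl st scale1r.
- by exists (d0 - y); exists d0 => //; exact: clD.
- exact: De.
have bu : bounded_fun_norm u.
  move=> r; exists r => x xr; apply: le_trans xr.
  rewrite ler_norml ule andbT lerNl -[- _]linearN.
  by apply: le_trans (ule _) _; rewrite normrN.
have := sep u (e + u y) bu.
have h d : D d -> e + u y <= u d.
  move=> Dd; have := uD (d - y); rewrite linearB -lerBrDr.
  by apply; exists d => //; exact: clD.
by move=> /(_ h); rewrite gerDr leNgt e0.
Qed.

(** Half-spaces given by bounded functionals are weakly closed. This is what puts
    weak cluster points within the reach of [mazur_closure]. *)
Lemma weak_cluster_ge (F : set_system V) y u c : Filter F ->
    bounded_fun_norm u -> @cluster (weak V) F y ->
  F [set z | c <= u z] -> c <= u y.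
Proof.
move=> FF bu cly Fc; rewrite leNgt; apply/negP => uyc.
pose fu : dual V := exist _ u bu.
have nyc : @nbhs _ (weak V) y [set z | u z < c].
  have /(_ fu) := (@cvg_sup V _ (fun f : dual V =>
    Topological.class (initial_topology (proj1_sig f : V -> R^o)))
    (@nbhs _ (weak V) y) y (@nbhs_filter (weak V) y)).1 (fun A h => h).
  apply; apply: (@initial_continuous V R^o u y [set r | r < c]).
  by apply: lt_nbhsl.
by have [z [/= cz zc]] := cly _ _ Fc nyc; move: zc; rewrite ltNge cz.
Qed.

End NormedSpace.

Section OperatorNorm.
Context {R : realType} {V W : normedModType R}.
Implicit Types T : V -> W.

Lemma ler_opnorm T x : bounded_fun_norm T -> `|x| <= 1 -> `|T x| <= opnorm T.
Proof.
move=> bT x1; apply: ub_le_sup; last by exists x.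
by have [M TM] := bT 1; exists M => _ [z z1 <-]; exact: TM.
Qed.

Lemma lt_opnorm T c : c < opnorm T -> exists2 x, `|x| <= 1 & c < `|T x|.
Proof.
move=> /sup_gt[|_ [x x1 <-] cT]; last by exists x.
by exists `|T 0|; exists 0 => //; rewrite /unit_ball/= normr0.
Qed.

Lemma opnorm_le T c : (forall x, `|x| <= 1 -> `|T x| <= c) -> opnorm T <= c.
Proof.
move=> Tc; apply: ge_sup; last by move=> _ [x x1 <-]; exact: Tc.
by exists `|T 0|; exists 0 => //; rewrite /unit_ball/= normr0.
Qed.

End OperatorNorm.

(** * Slices under the Daugavet property *)

(** The condition [0 <= a] excludes [f = 0], so that [f] has positive norm. *)
Definition open_slice {R : realType} {V : normedModType R} (S : set V) :=
  S !=set0 /\ exists (f : {linear V -> R^o}) (a : R),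
    [/\ bounded_fun_norm f, 0 <= a & S = [set x | `|x| <= 1 /\ a < f x]].

Lemma open_slice_midpoint {R : realType} {V : normedModType R} (S : set V) :
  open_slice S -> midpoint_closed S.
Proof.
move=> [_ [f [a [_ _ ->]]]] x z [x1 fx] [z1 fz]; split.
  rewrite normrZ ger0_norm ?invr_ge0//.
  have := ler_normD x z; lra.
by rewrite functionalZ linearD; lra.
Qed.

Section Daugavet.
Context {R : realType} {Y : normedModType R} {X : submodClosed Y}.
Local Notation E := (subspace_type X).

Lemma inclusionD (x z : E) : \val (x + z) = \val x + \val z.
Proof. exact: raddfD. Qed.

Lemma inclusionZ t (x : E) : \val (t *: x) = t *: \val x.
Proof. exact: linearZ. Qed.

Lemma inclusionN (x : E) : \val (- x) = - \val x.
Proof. exact: raddfN. Qed.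

Lemma inclusion0 : \val (0 : E) = 0.
Proof. exact: raddf0. Qed.

Context (DP : daugavet_property X).

(** The Daugavet equation for [x |-> (f x / s) y], whose norm is [`|y|]. Changing
    [x] to [- x] preserves the norm in question and allows [0 <= f x]. *)
Lemma daugavet_rank_one (f : {linear E -> R^o}) (s : R) (y : Y) e :
    bounded_fun_norm f -> s = opnorm f -> 0 < s -> y != 0 -> 0 < e ->
  exists2 x : E, `|x| <= 1 & 0 <= f x /\
    1 + `|y| - e < `|\val x + (s^-1 * f x) *: y|.
Proof.
move=> bf sE s0 yn0 e0.
have y0 : 0 < `|y| by rewrite normr_gt0.
have [T TE] : exists T : {linear E -> Y},
    T = (fun x => (s^-1 * f x) *: y) :> (E -> Y).
  apply: ex_linear => [x z|t x].
    by rewrite linearD mulrDr scalerDl.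
  by rewrite functionalZ mulrCA scalerA.
have bT : bounded_fun_norm T.
  move=> r; have [M fM] := bf r; exists (s^-1 * M * `|y|) => x xr.
  rewrite TE normrZ ler_wpM2r// normrM gtr0_norm ?invr_gt0//.
  by rewrite ler_wpM2l ?fM ?invr_ge0 ?(ltW s0).
have Tr : rank_one T.
  exists y => //.
  have [x1 _ fx1] : exists2 x, `|x| <= 1 & 0 < `|f x|.
    by apply: lt_opnorm; rewrite -sE.
  rewrite TE; apply/seteqP; split=> [_ [x _ <-]|_ [c _ <-]].
    by exists (s^-1 * f x).
  exists ((c * s / f x1) *: x1) => //.
  rewrite functionalZ divfK -?normr_gt0// mulrC.
  by rewrite mulfK ?gt_eqF.
have yT : `|y| <= opnorm T.
  rewrite leNgt; apply/negP => Ty.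
  have : opnorm T * s / `|y| < opnorm f.
    by rewrite -sE ltr_pdivrMr// mulrC ltr_pM2l.
  move=> /lt_opnorm[x x1 xf].
  have := ler_opnorm _ x bT x1; apply/negP; rewrite -ltNge.
  have -> : T x = (s^-1 * f x) *: y by rewrite TE.
  rewrite normrZ normrM gtr0_norm ?invr_gt0// -mulrA ltr_pdivlMl//.
  by move: xf; rewrite ltr_pdivrMr// mulrC.
have := DP T bT Tr => JT.
have /lt_opnorm[x x1] : 1 + `|y| - e < opnorm (\val \+ T).
  by rewrite JT; lra.
rewrite /= TE => xT.
have [fx|fx] := leP 0 (f x); first by exists x.
exists (- x); first by rewrite normrN.
rewrite linearN inclusionN oppr_ge0 ltW//; split => //.
by rewrite mulrN scaleNr -opprD normrN.
Qed.

(** With [h] the normalization of [f], take [x0] almost norming [J + h (x) y] and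
    [u] norming [x0 + h x0 y]. Then [u y] is close to [`|y|], and
    [g = `|y| h + u] almost reaches its largest possible value [1 + `|y|] at [x0].
    Wherever [g] is that large, both [h] and [u] are close to [1]: the former puts
    the point in [S], the latter gives [`|x + y| >= u x + u y >= 1 + `|y| - e]. *)
Lemma daugavet_slice (S : set E) (y : Y) e : open_slice S -> 0 < e ->
  exists S', [/\ open_slice S', S' `<=` S &
    forall x, S' x -> 1 + `|y| - e <= `|\val x + y|].
Proof.
move=> sliceS; wlog yn0 : y e / y != 0 => [hwlog e0|e0].
  have [y0|] := eqVneq y 0; last by move=> yn0; exact: hwlog.
  have [[x Sx] [f [a [bf a0 SE]]]] := sliceS.
  have xn0 : 0 < `|\val x|.
    rewrite normr_gt0; apply/eqP => x0; move: Sx; rewrite SE /= => -[_].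
    have -> : x = 0 by apply: val_inj; rewrite x0 inclusion0.
    by rewrite linear0 ltNge a0.
  (* The zero vector is replaced by a small nonzero one. *)
  pose z : Y := (e / 3 / `|\val x|) *: \val x.
  have zE : `|z| = e / 3.
    by rewrite normrZ ger0_norm ?divfK ?gt_eqF// !divr_ge0// ltW.
  have zn0 : z != 0 by rewrite -normr_gt0 zE divr_gt0.
  have [|S' [sliceS' S'S S'z]] := hwlog z (e / 3) zn0; first by rewrite divr_gt0.
  exists S'; split=> // w /S'z; rewrite y0 normr0 !addr0 zE => h.
  have := ler_normD (\val w) z; rewrite zE; lra.
have y0 : 0 < `|y| by rewrite normr_gt0.
have [[x1 Sx1] [f [a [bf a0 SE]]]] := sliceS.
pose s := opnorm f.
have as_ : a < s.
  move: Sx1; rewrite SE => -[x11 afx].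
  by apply: lt_le_trans (ler_opnorm f x1 bf x11); apply: lt_le_trans (ler_norm _).
have s0 : 0 < s by exact: le_lt_trans as_.
pose h x := s^-1 * f x.
have h1 x : `|x| <= 1 -> h x <= 1.
  move=> xle; rewrite /h mulrC ler_pdivrMr// mul1r.
  by apply: le_trans (ler_opnorm f x bf xle); exact: ler_norm.
(* [d <= e / 2] serves the norm estimate, and the other bound makes
   [h x > 1 - d / `|y|] imply [h x > a / s], that is, [f x > a]. *)
pose d := Num.min (e / 2) (`|y| * (1 - a / s)).
have d0 : 0 < d.
  by rewrite lt_min divr_gt0//= mulr_gt0// subr_gt0 ltr_pdivrMr// mul1r.
have de : d <= e / 2 by rewrite ge_min lexx.
have dy : d <= `|y| * (1 - a / s) by rewrite ge_min lexx orbT.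
have dy1 : d <= `|y|.
  by apply: le_trans dy _; rewrite ger_pMr// gerBl divr_ge0// ltW.
have [x0 x01 [fx0 x0y]] := daugavet_rank_one f s y d bf erefl s0 yn0 d0.
have [u [u1 ux0]] := norming_functional (\val x0 + h x0 *: y).
have ule z : u z <= `|z| by apply: le_trans (u1 z); exact: ler_norm.
have [g gE] : exists g : {linear E -> R^o},
    g = (fun x => `|y| * h x + u (\val x)) :> (E -> R^o).
  apply: ex_linear => [x z|t x]; rewrite /h.
    by rewrite inclusionD !linearD /= !mulrDr addrACA.
  rewrite functionalZ inclusionZ functionalZ scalerDr.
  congr (_ + _); transitivity (t * (`|y| * (s^-1 * f x))) => //.
  by rewrite !(mulrCA _ t).
move: ux0; rewrite linearD functionalZ => ux0.
rewrite -ux0 in x0y.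
have hx0 : 0 <= h x0 by rewrite mulr_ge0// invr_ge0 ltW.
have ux01 : u (\val x0) <= 1 by apply: le_trans (ule _) _; exact: x01.
have huy : `|y| - d < h x0 * u y by lra.
have uy0 : 0 <= u y.
  rewrite leNgt; apply/negP => uy0.
  have := mulr_ge0_le0 hx0 (ltW uy0); lra.
have uy : `|y| - d < u y.
  by apply: lt_le_trans huy _; rewrite ler_piMl// h1.
exists [set x | `|x| <= 1 /\ 1 + `|y| - d < g x]; split.
- split.
    exists x0; split=> //; rewrite gE; apply: lt_le_trans x0y _.
    by rewrite addrC lerD2r mulrC ler_wpM2r.
  exists g, (1 + `|y| - d); split=> //; last lra.
  move=> r; have [M fM] := bf r; exists (`|y| * (s^-1 * M) + r) => x xr.
  rewrite gE; apply: le_trans (ler_normD _ _) _; apply: lerD; last first.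
    exact: le_trans (u1 _) xr.
  rewrite normrM normr_id ler_wpM2l// normrM gtr0_norm ?invr_gt0//.
  by rewrite ler_wpM2l ?fM ?invr_ge0 ?(ltW s0).
- move=> x [x1' gx]; rewrite SE; split=> //; rewrite gE /= in gx.
  have ux : u (\val x) <= 1 by apply: le_trans (ule _) _; exact: x1'.
  have : `|y| * (a / s) < `|y| * h x.
    by apply: (@le_lt_trans _ _ (`|y| - d)); lra.
  by rewrite ltr_pM2l// /h mulrC ltr_pM2l ?invr_gt0.
- move=> x [x1' gx]; rewrite gE /= in gx.
  apply: le_trans (ule _); rewrite linearD.
  have := ler_wpM2l (ltW y0) (h1 _ x1'); lra.
Qed.

Lemma daugavet_slice_seq (S : set E) (L : seq Y) e : open_slice S -> 0 < e ->
  exists S', [/\ open_slice S', S' `<=` S &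
    forall y x, y \in L -> S' x -> 1 + `|y| - e <= `|\val x + y|].
Proof.
move=> sliceS e0; elim: L => [|y L [S1 [sliceS1 S1S S1L]]].
  by exists S; split=> // y x; rewrite in_nil.
have [S2 [sliceS2 S2S1 S2y]] := daugavet_slice _ y _ sliceS1 e0.
exists S2; split=> //; first by move=> x /S2S1/S1S.
move=> z x; rewrite inE => /predU1P[->|zL] S2x; first exact: S2y.
by apply: S1L => //; exact: S2S1.
Qed.

End Daugavet.

Lemma midpointxx {R : realType} {V : lmodType R} (v : V) :
  2^-1 *: (v + v) = v.
Proof.
by rewrite -mulr2n -[v *+ 2]scaler_nat scalerA mulVf ?pnatr_eq0// scale1r.
Qed.

(** * Weakly compact operators *)

Section WeaklyCompact.
Context {R : realType} {Y : normedModType R} {X : submodClosed Y}.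
Local Notation E := (subspace_type X).
Context (DP : daugavet_property X).

(** Each stage keeps a slice, a finite list of vectors and a point of the slice.
    The next list consists of the midpoints of the current list enlarged by the
    image of the current point. Since a vector is its own midpoint the lists
    increase, so their union [D] is stable under midpoints. *)
Lemma daugavet_sequence (T : E -> Y) (S0 : set E) e : open_slice S0 -> 0 < e ->
  exists (S : nat -> set E) (x : nat -> E) (D : set Y),
  [/\ S 0%N = S0 /\ (forall m n, (m <= n)%N -> S n `<=` S m),
      forall n, open_slice (S n),
      forall n, S n (x n),
      midpoint_closed D /\ (forall n, D (T (x n))) &
      forall d, D d -> exists n, forall z, S n z ->
        1 + `|d| - e <= `|\val z + d|].
Proof.
move=> sliceS0 e0.
have [x0 S0x0] := sliceS0.1.
pose mid (s : seq Y) := [seq 2^-1 *: (a + b) | a <- s, b <- s].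
pose state := {s : set E * seq Y * E | open_slice s.1.1 /\ s.1.1 s.2}.
pose S_ (s : state) := (sval s).1.1.
pose L_ (s : state) := (sval s).1.2.
pose x_ (s : state) := (sval s).2.
pose next (s s' : state) := [/\ S_ s' `<=` S_ s, L_ s' = mid (T (x_ s) :: L_ s) &
  forall d z, d \in L_ s' -> S_ s' z -> 1 + `|d| - e <= `|\val z + d|].
have [s|f [f0 fS]] := @dependent_choice state next _
    (exist _ (S0, [::], x0) (conj sliceS0 S0x0)).
  apply: cid.
  have [S' [sliceS' S'S S'L]] := daugavet_slice_seq DP (S_ s)
    (mid (T (x_ s) :: L_ s)) e (svalP s).1 e0.
  have [x' S'x'] := sliceS'.1.
  by exists (exist _ (S', mid (T (x_ s) :: L_ s), x') (conj sliceS' S'x')).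
have LS n d : d \in L_ (f n) -> d \in L_ (f n.+1).
  move=> dL; have [_ -> _] := fS n; apply/allpairsP; exists (d, d).
  by rewrite !inE dL orbT; split=> //=; rewrite midpointxx.
have Lle m n d : (m <= n)%N -> d \in L_ (f m) -> d \in L_ (f n).
  by move=> /subnK <- dL; elim: (n - m)%N => // k; rewrite addSn; exact: LS.
have Sle m n : (m <= n)%N -> S_ (f n) `<=` S_ (f m).
  move=> /subnK <-; elim: (n - m)%N => // k IH z; rewrite addSn => Sz.
  by apply: IH; have [+ _ _] := fS (k + m)%N; apply.
exists (S_ \o f), (x_ \o f), [set d | exists n, d \in L_ (f n)]; split=> /=.
- by rewrite f0; split=> // m n; exact: Sle.
- by move=> n; exact: (svalP (f n)).1.
- by move=> n; exact: (svalP (f n)).2.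
- split=> [a b [m am] [n bn]|n].
    exists (maxn m n).+1; have [_ -> _] := fS (maxn m n).
    apply/allpairsP; exists (a, b); split=> //=; rewrite inE.
      by rewrite (Lle _ _ _ (leq_maxl m n) am) orbT.
    by rewrite (Lle _ _ _ (leq_maxr m n) bn) orbT.
  exists n.+1; have [_ -> _] := fS n; apply/allpairsP.
  exists (T (x_ (f n)), T (x_ (f n))); rewrite !inE eqxx; split=> //=.
  by rewrite midpointxx.
- move=> d [n dn]; exists n.+1 => z Sz; have [_ _] := fS n.
  by apply => //; exact: LS.
Qed.

(** A weak cluster point [y] of [T (x n)] lies in the norm closure of [D] and of
    every [T @` S n]; [d] in [D] has to be chosen before [n], because the index
    from which the slices are good for [d] depends on [d]. *)
Lemma daugavet_weakly_compact_slice (T : {linear E -> Y}) (S : set E) e :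
    weakly_compact T -> open_slice S -> 0 < e ->
  exists2 x, S x & 1 + `|T x| - e <= `|\val x + T x|.
Proof.
move=> [U TU [cU _]] sliceS e0.
have e5 : 0 < e / 5 by rewrite divr_gt0.
have [S_ [x [D [[S_0 S_le] sliceS_ S_x [midD DTx] DS_]]]] :=
  daugavet_sequence T S (e / 5) sliceS e5.
have xball n : `|x n| <= 1.
  have [_ [f [a [_ _ SE]]]] := sliceS_ 0%N.
  by have := S_le _ _ (leq0n n) _ (S_x n); rewrite SE => -[].
pose F := ((T \o x) @ \oo : set_system (weak Y)).
have FU : F U by exists 0%N => // n _; apply: TU; exists (x n) => //; exact: xball.
have [y [_ cly]] := cU F _ FU.
have clDy : closure D y.
  apply: mazur_closure => //; first by exists (T (x 0%N)).
  move=> u c bu Dc; apply: (weak_cluster_ge F y u c) => //.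
  by exists 0%N => // n _; apply: Dc; exact: DTx.
have [d Dd yd] := (closure_normP D y).1 clDy _ e5.
have [n S_nd] := DS_ d Dd.
have clTy : closure (T @` S_ n) y.
  apply: mazur_closure.
  - move=> _ _ [z1 Sz1 <-] [z2 Sz2 <-]; exists (2^-1 *: (z1 + z2)).
      exact: open_slice_midpoint.
    by rewrite linearZ linearD.
  - by exists (T (x n)); exists (x n) => //; exact: S_x.
  move=> u c bu Tc; apply: (weak_cluster_ge F y u c) => //.
  exists n => // m nm; apply: Tc; exists (x m); last by [].
  exact: (S_le _ _ nm) (S_x m).
have [_ [z Sz <-] yz] := (closure_normP _ y).1 clTy _ e5.
exists z; first by rewrite -S_0; exact: S_le (leq0n n) _ Sz.
have dTz : `|d - T z| < e / 5 + e / 5.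
  apply: le_lt_trans (ler_distD y _ _) _.
  by rewrite (distrC d) ltrD.
have := S_nd z Sz; have := ler_distD d 0 (T z); rewrite !sub0r !normrN.
have -> : \val z + d = \val z + T z + (d - T z).
  by rewrite [d - T z]addrC addrA addrK.
have := ler_normD (\val z + T z) (d - T z); lra.
Qed.

End WeaklyCompact.

Theorem theorem2p3 (R : realType) (Y : completeNormedModType R)
    (X : submodClosed Y) :
  closed [set y : Y | y \in X] ->
  (exists2 x : Y, x \in X & x != 0) ->
  daugavet_property X ->
  daugavet_property_for (@weakly_compact R (subspace_type X) Y).
Proof.
move=> _ [x0 Xx0 x0n0] DP T bT wT.
have bJT : bounded_fun_norm (\val \+ T : subspace_type X -> Y).
  move=> r; have [M TM] := bT r; exists (r + M) => x xr /=.
  by apply: le_trans (ler_normD _ _) _; apply: lerD; [exact: xr|exact: TM].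
apply/le_anti/andP; split.
  apply: opnorm_le => x x1 /=; apply: le_trans (ler_normD _ _) _.
  by apply: lerD; [exact: x1|exact: ler_opnorm].
(* A slice of the form [a < u (T z)] with [0 <= a] exists only if the norm of [T]
   is positive; otherwise a unit vector of [X] suffices. *)
have [T0|T0] := leP (opnorm T) 0.
  pose z : subspace_type X := exist _ x0 Xx0.
  pose x := `|x0|^-1 *: z.
  have x1 : `|x| = 1.
    rewrite normrZ ger0_norm ?invr_ge0// [`|z|](_ : _ = `|x0|)//.
    by rewrite mulVf// normr_eq0.
  have := ler_opnorm _ x bT; rewrite x1 => /(_ (lexx _)) Tx.
  have := ler_opnorm _ x bJT; rewrite x1 => /(_ (lexx _)) /= JTx.
  have := ler_normB (\val x + T x) (T x).
  rewrite addrK [`|\val x|](_ : _ = `|x|)// x1; lra.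
apply/ler_addgt0Pr => e e0.
pose a := opnorm T - Num.min (e / 2) (opnorm T).
have a0 : 0 <= a by rewrite subr_ge0 ge_min lexx orbT.
have ae : opnorm T - e / 2 <= a by rewrite lerD2l lerN2 ge_min lexx.
have /lt_opnorm[x x1 ax] : a < opnorm T by rewrite gtrBl lt_min T0 divr_gt0.
have [u [u1 uTx]] := norming_functional (T x).
have [f fE] : exists f : {linear subspace_type X -> R^o},
    f = (fun z => u (T z)) :> (subspace_type X -> R^o).
  by apply: ex_linear => [v w|t v]; rewrite ?linearD ?linearZ.
have sliceS : open_slice [set z | `|z| <= 1 /\ a < f z].
  split; first by exists x; split=> //; rewrite fE uTx.
  exists f, a; split=> // r; have [M TM] := bT r; exists M => z zr.
  by rewrite fE; apply: le_trans (u1 _) (TM _ zr).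
have [|z [z1 fz] Jz] := daugavet_weakly_compact_slice DP T _ (e / 2) wT sliceS.
  by rewrite divr_gt0.
have := ler_opnorm _ z bJT z1; rewrite /= => JTz.
move: fz; rewrite fE => fz.
have := le_trans (ler_norm _) (u1 (T z)).
lra.
Qed.
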